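(* Let $(\mathfrak{S},\mathfrak{C})$ be an EPRB-system, i.e. $\mathfrak{S}=\{(V_i,W_{i\oplus_4 1}):i\in\{1,\ldots,4\}\}$ and $\mathfrak{C}=\{\{V_i,W_i\}:i\in\{1,\ldots,4\}\}$. Then $$\Delta_0(\mathfrak{C})=\frac12\sum_{i=1}^4|\langle V_i\rangle-\langle W_i\rangle|,\qquad \Delta_{\min}(\mathfrak{S},\mathfrak{C})=\frac12\max\Big(2\Delta_0(\mathfrak{C}),\ \mathsf{s}_{odd}\big(\langle V_iW_{i\oplus_4 1}\rangle:i\in\{1,\ldots,4\}\big)-2\Big).$$ Consequently $$\mathsf{CNTX}(\mathfrak{S},\mathfrak{C})=\frac12\max\Big(0,\ \mathsf{s}_{odd}\big(\langle V_iW_{i\oplus_4 1}\rangle:i\in\{1,\ldots,4\}\big)-2-\sum_{i=1}^4|\langle V_i\rangle-\langle W_i\rangle|\Big),$$ and the system has a noncontextual description if and only if $$\mathsf{s}_{odd}\big(\langle V_iW_{i\oplus_4 1}\rangle:i\in\{1,\ldots,4\}\big)\le 2+\sum_{i=1}^4|\langle V_i\rangle-\langle W_i\rangle|.$$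
   Context: $\oplus_4$ denotes cyclic addition on $\{1,2,3,4\}$ ($4\oplus_4 1=1$). All $V_i,W_i$ are $\pm1$-valued random variables. Each pair $(V_i,W_{i\oplus_4 1})$ is jointly distributed, but variables in different pairs are stochastically unrelated (have no given joint distribution); in particular $V_i$ and $W_i$ are never jointly distributed. $\langle\cdot\rangle$ denotes expectation; $\langle V_iW_{i\oplus_4 1}\rangle$ is computed from the given joint distribution of the pair. A coupling of random variables $A,B$ is a jointly distributed pair $(A^*,B^* )$ with $A^*\sim A$, $B^*\sim B$; it is maximal if $\Pr[A^*=B^*]$ is the largest possible over all couplings. A coupling $S$ of $\mathfrak{S}$ is a jointly distributed 8-tuple $(V_1^*,\ldots,V_4^*,W_1^*,\ldots,W_4^* )$ with $(V_i^*,W_{i\oplus_4 1}^* )$ distributed as $(V_i,W_{i\oplus_4 1})$ for each $i$. The system has a (maximally) noncontextual description if some coupling $S$ has each $(V_i^*,W_i^* )$ a maximal coupling of $V_i,W_i$. $\Delta_0(\mathfrak{C})=\frac12\sum_i|\langle V_i\rangle-\langle W_i\rangle|$; $\Delta_{\min}(\mathfrak{S},\mathfrak{C})$ is the infimum over all couplings $S$ of $\sum_{i=1}^4\Pr[V_i^*\ne W_i^*]$; $\mathsf{CNTX}(\mathfrak{S},\mathfrak{C})=\Delta_{\min}(\mathfrak{S},\mathfrak{C})-\Delta_0(\mathfrak{C})$. For reals $a_1,\ldots,a_m$, $\mathsf{s}_{odd}(a_1,\ldots,a_m)$ is the maximum of $\sum_{i=1}^m(\pm a_i)$ over all sign choices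 with an odd number of minus signs. *)

(* Defs.v *)
From HB Require Import structures.
From mathcomp Require Import all_boot all_order all_algebra.
From mathcomp Require Import classical_sets reals.
Set Implicit Arguments. Unset Strict Implicit. Unset Printing Implicit Defensive.
Import Order.TTheory GRing.Theory Num.Theory.
Local Open Scope ring_scope.


Section EPRB.
Variable R : realType.

(* a +-1 valued random variable takes values in bool; true = +1, false = -1 *)
Definition sgn (b : bool) : R := if b then 1 else -1.

Definition is_distr (T : finType) (p : {ffun T -> R}) : Prop :=
  (forall x, 0 <= p x) /\ \sum_x p x = 1.

(* cyclic successor / predecessor on 'I_4 = {1,2,3,4} (shifted to 0..3) *)
Definition oplus1 (i : 'I_4) : 'I_4 := ordS i.
Definition ominus1 (i : 'I_4) : 'I_4 := ord_pred i.

(* An EPRB system: P i is the joint distribution of the pair (V_i, W_{i (+) 1}). *)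
Definition EPRB_system (P : 'I_4 -> {ffun bool * bool -> R}) : Prop :=
  forall i, is_distr (P i).

(* <V_i> and <W_i>; W_i occurs in the pair with index i (-) 1 *)
Definition EV (P : 'I_4 -> {ffun bool * bool -> R}) (i : 'I_4) : R :=
  \sum_(x : bool * bool) P i x * sgn x.1.
Definition EW (P : 'I_4 -> {ffun bool * bool -> R}) (i : 'I_4) : R :=
  \sum_(x : bool * bool) P (ominus1 i) x * sgn x.2.
Definition Ecorr (P : 'I_4 -> {ffun bool * bool -> R}) (i : 'I_4) : R :=
  \sum_(x : bool * bool) P i x * (sgn x.1 * sgn x.2).

Definition Delta0 (P : 'I_4 -> {ffun bool * bool -> R}) : R :=
  2^-1 * \sum_(i < 4) `|EV P i - EW P i|.

(* sample space of the coupled 8-tuple: a pair of sign vectors, starred V and starred W *)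
Definition Omega := ({ffun 'I_4 -> bool} * {ffun 'I_4 -> bool})%type.

Definition is_coupling (P : 'I_4 -> {ffun bool * bool -> R}) (S : {ffun Omega -> R})
  : Prop :=
  is_distr S /\
  forall (i : 'I_4) (a b : bool),
    \sum_(w : Omega | (w.1 i == a) && (w.2 (oplus1 i) == b)) S w = P i (a, b).

Definition mismatch (S : {ffun Omega -> R}) (i : 'I_4) : R :=
  \sum_(w : Omega | w.1 i != w.2 i) S w.

Definition Deltamin (P : 'I_4 -> {ffun bool * bool -> R}) : R :=
  inf [set x : R | exists S, is_coupling P S /\ x = \sum_(i < 4) mismatch S i]%classic.

Definition CNTX (P : 'I_4 -> {ffun bool * bool -> R}) : R := Deltamin P - Delta0 P.

Definition lawV (P : 'I_4 -> {ffun bool * bool -> R}) (i : 'I_4) (a : bool) : R :=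
  \sum_(b : bool) P i (a, b).
Definition lawW (P : 'I_4 -> {ffun bool * bool -> R}) (i : 'I_4) (b : bool) : R :=
  \sum_(a : bool) P (ominus1 i) (a, b).

Definition is_coupling2 (pa pb : bool -> R) (q : {ffun bool * bool -> R}) : Prop :=
  is_distr q /\ (forall a, \sum_(b : bool) q (a, b) = pa a)
             /\ (forall b, \sum_(a : bool) q (a, b) = pb b).

Definition agree (q : {ffun bool * bool -> R}) : R := \sum_(a : bool) q (a, a).

Definition maximal_coupling (pa pb : bool -> R) (q : {ffun bool * bool -> R}) : Prop :=
  is_coupling2 pa pb q /\ forall q', is_coupling2 pa pb q' -> agree q' <= agree q.

Definition pair_law (S : {ffun Omega -> R}) (i : 'I_4) : {ffun bool * bool -> R} :=
  [ffun x : bool * bool => \sum_(w : Omega | (w.1 i == x.1) && (w.2 i == x.2)) S w].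

Definition noncontextual (P : 'I_4 -> {ffun bool * bool -> R}) : Prop :=
  exists S, is_coupling P S /\
    forall i : 'I_4, maximal_coupling (lawV P i) (lawW P i) (pair_law S i).

(* s_odd: max of sum (+-a_i) over sign choices with an odd number of minus
   signs (s i = true means a minus sign at i).  The big max is seeded with the
   value of one admissible choice (minus only at index 0), so it is exactly the
   maximum over the admissible choices. *)
Definition signed_sum (a : 'I_4 -> R) (s : {ffun 'I_4 -> bool}) : R :=
  \sum_(i < 4) (if s i then - a i else a i).
Definition s_odd (a : 'I_4 -> R) : R :=
  \big[Num.max/signed_sum a [ffun i : 'I_4 => i == ord0]]_(s : {ffun 'I_4 -> bool}
      | odd #|[set i | s i]|) signed_sum a s.

End EPRB.

(* Main.v *)
Require Import Defs.
From HB Require Import structures.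
From mathcomp Require Import all_boot all_order all_algebra.
From mathcomp Require Import classical_sets reals.
From mathcomp Require Import lra ring.
Import Order.TTheory GRing.Theory Num.Theory.
Local Open Scope ring_scope.

(* The laws of signs and of pairs of signs are determined by their means and
   correlations.  The lower bound on the mismatches holds pointwise: the product
   of the eight signs V_i W_(i+1), V_i W_i around the cycle is 1.

   For the upper bound, read the system as the path
     V_0 - W_1 - V_1 - W_2 - V_2 - W_3 - V_3 - W_0,
   with the given laws on the edges V_i W_(i+1) and maximal couplings on the
   edges W_i V_i, i <> 0.  Gluing the edges one at a time, conditionally on the
   first and the last vertex, realizes every correlation of the two endpoints in
   an explicit interval; its upper end is the smaller of the value of a maximal
   coupling of V_0 and W_0 and the value at which the s_odd bound is attained.  So
   at most one of the four mismatches ever has to exceed its minimum. *)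

(** * Signs: laws from moments, and conditional gluing *)

Section Moments.
Set Implicit Arguments.
Unset Strict Implicit.
Variable R : realType.
Local Notation sg := (sgn R).

Lemma sum_bool2 (F : bool * bool -> R) :
  \sum_x F x = F (true, true) + F (true, false) + F (false, true) + F (false, false).
Proof.
rewrite (eq_bigr (fun x => F (x.1, x.2))); last by case.
by rewrite -(pair_bigA _ (fun a b => F (a, b))) /= !big_bool /= !addrA.
Qed.

Definition expect (T : finType) (S : {ffun T -> R}) (f : T -> R) : R :=
  \sum_w S w * f w.

Lemma eq_expect (T : finType) (S : {ffun T -> R}) (f g : T -> R) :
  f =1 g -> expect S f = expect S g.
Proof. by move=> fg; apply: eq_bigr => w _; rewrite fg. Qed.

Lemma expectD (T : finType) (S : {ffun T -> R}) (f g : T -> R) :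
  expect S (fun w => f w + g w) = expect S f + expect S g.
Proof. by rewrite /expect -big_split; apply: eq_bigr => w _; rewrite mulrDr. Qed.

Lemma expectZ (T : finType) (S : {ffun T -> R}) (c : R) (f : T -> R) :
  expect S (fun w => c * f w) = c * expect S f.
Proof. by rewrite /expect big_distrr; apply: eq_bigr => w _ /=; rewrite mulrCA. Qed.

Lemma expect_cst (T : finType) (S : {ffun T -> R}) (c : R) :
  is_distr S -> expect S (fun=> c) = c.
Proof. by case=> _ S1; rewrite /expect -big_distrl /= S1 mul1r. Qed.

Lemma expect_sum (T I : finType) (S : {ffun T -> R}) (f : I -> T -> R) :
  expect S (fun w => \sum_i f i w) = \sum_i expect S (f i).
Proof.
by rewrite /expect exchange_big; apply: eq_bigr => w _ /=; rewrite big_distrr.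
Qed.

Lemma expect_le (T : finType) (S : {ffun T -> R}) (f g : T -> R) :
  is_distr S -> (forall w, f w <= g w) -> expect S f <= expect S g.
Proof. by move=> [S0 _] fg; apply: ler_sum => w _; rewrite ler_wpM2l. Qed.

Lemma prob_expect (T : finType) (S : {ffun T -> R}) (p : pred T) :
  \sum_(w | p w) S w = expect S (fun w => (p w)%:R).
Proof.
rewrite big_mkcond /expect; apply: eq_bigr => w _.
by case: (p w); rewrite ?mulr1 ?mulr0.
Qed.

(** The indicator of [X w = a] is [(1 + sg a * sg (X w)) / 2]; multiply two of these and average. *)
Lemma joint_lawE (T : finType) (S : {ffun T -> R}) (X Y : T -> bool) (a b : bool) :
  is_distr S ->
  \sum_(w | (X w == a) && (Y w == b)) S w =
  4^-1 * (1 + sg a * expect S (fun w => sg (X w)) + sg b * expect S (fun w => sg (Y w))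
          + sg a * sg b * expect S (fun w => sg (X w) * sg (Y w))).
Proof.
move=> Sd; rewrite prob_expect -[X in X + sg a * _](expect_cst 1 Sd)
  -!expectZ -!expectD -expectZ; apply: eq_expect => w /=.
by case: (X w); case: (Y w); case: a; case: b; rewrite /sgn /=; lra.
Qed.

Lemma mismatchE (T : finType) (S : {ffun T -> R}) (X Y : T -> bool) :
  is_distr S ->
  \sum_(w | X w != Y w) S w = 2^-1 * (1 - expect S (fun w => sg (X w) * sg (Y w))).
Proof.
move=> Sd; rewrite prob_expect -[X in X - _](expect_cst 1 Sd) -mulN1r
  -expectZ -expectD -expectZ; apply: eq_expect => w /=.
by case: (X w); case: (Y w); rewrite /sgn /=; lra.
Qed.

Lemma expect_sgn_bound (T : finType) (S : {ffun T -> R}) (X : T -> bool) :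
  is_distr S -> `|expect S (fun w => sg (X w))| <= 1.
Proof.
move=> Sd; rewrite ler_norml -[X in X <= _](expect_cst (-1) Sd)
  -[X in _ && (_ <= X)](expect_cst 1 Sd).
by apply/andP; split; apply: expect_le => // w; case: (X w); rewrite /sgn; lra.
Qed.

(** The four probabilities of [joint_lawE] are nonnegative: equal signs give the lower bound,
    opposite signs the upper one. *)
Lemma expect_corr_bound (T : finType) (S : {ffun T -> R}) (X Y : T -> bool) :
  is_distr S ->
  `|expect S (fun w => sg (X w)) + expect S (fun w => sg (Y w))| - 1
    <= expect S (fun w => sg (X w) * sg (Y w))
    <= 1 - `|expect S (fun w => sg (X w)) - expect S (fun w => sg (Y w))|.
Proof.
move=> Sd; set x := expect S (fun w => sg (X w)); set y := expect S (fun w => sg (Y w)).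
set c := expect S _.
have H a b : 0 <= 1 + sg a * x + sg b * y + sg a * sg b * c.
  have := joint_lawE X Y a b Sd; rewrite -/x -/y -/c => E.
  have : 0 <= \sum_(w | (X w == a) && (Y w == b)) S w.
    by apply: sumr_ge0 => w _; case: Sd.
  by rewrite E; lra.
move: (H true true) (H true false) (H false true) (H false false); rewrite /sgn => *.
have h1 : `|x + y| <= 1 + c by rewrite ler_norml; lra.
have h2 : `|x - y| <= 1 - c by rewrite ler_norml; lra.
by apply/andP; split; lra.
Qed.

Definition pushforward (T U : finType) (S : {ffun T -> R}) (F : T -> U) : {ffun U -> R} :=
  [ffun u => \sum_(t | F t == u) S t].

Lemma expect_pushforward (T U : finType) (S : {ffun T -> R}) (F : T -> U) (f : U -> R) :
  expect (pushforward S F) f = expect S (fun t => f (F t)).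
Proof.
rewrite /expect [RHS](partition_big F xpredT) //=; apply: eq_bigr => u _.
by rewrite ffunE big_distrl /=; apply: eq_bigr => t /eqP ->.
Qed.

Lemma expect1 (T : finType) (S : {ffun T -> R}) :
  expect S (fun=> 1) = \sum_w S w.
Proof. by apply: eq_bigr => w _; rewrite mulr1. Qed.

Lemma pushforward_distr (T U : finType) (S : {ffun T -> R}) (F : T -> U) :
  is_distr S -> is_distr (pushforward S F).
Proof.
move=> [S0 S1]; split=> [u|]; first by rewrite ffunE sumr_ge0.
by rewrite -expect1 expect_pushforward expect1.
Qed.

(* Markov gluing: draw the new coordinate conditionally on [h w] only. *)
Lemma markov_extension (T A B : finType) (S : {ffun T -> R}) (h : T -> A)
    (t : {ffun A * B -> R}) :
  is_distr S -> (forall x, 0 <= t x) ->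
  (forall a, \sum_b t (a, b) = pushforward S h a) ->
  exists S' : {ffun T * B -> R},
    [/\ is_distr S', forall f, expect S' (fun w => f w.1) = expect S f
      & forall g, expect S' (fun w => g (h w.1, w.2)) = expect t g].
Proof.
move=> Sd t0 tS; set p := pushforward S h.
have p0 w : p (h w) = 0 -> S w = 0.
  rewrite ffunE => /eqP; rewrite psumr_eq0; last by move=> ? _; case: Sd.
  by move=> /allP/(_ w (mem_index_enum _)); rewrite eqxx => /eqP.
(* The quotient [t / p] is the conditional law of the new coordinate. Where [p (h w) = 0] it is [0],
   which is harmless since [S w = 0] there by [p0]. *)
pose S' := [ffun w : T * B => S w.1 * (t (h w.1, w.2) / p (h w.1))].
have M f : expect S' (fun w => f w.1) = expect S f.
  rewrite /expect (eq_bigr (fun w => S' (w.1, w.2) * f w.1)); last by case.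
  rewrite -(pair_bigA _ (fun a b => S' (a, b) * f a)) /=; apply: eq_bigr => w _.
  rewrite -big_distrl /=; congr (_ * _).
  under eq_bigr do rewrite ffunE /=.
  rewrite -big_distrr -big_distrl /= tS -/p.
  have [/p0->|pn] := eqVneq (p (h w)) 0; first by rewrite mul0r.
  by rewrite divff // mulr1.
exists S'; split=> //.
  split=> [w|]; first by rewrite ffunE mulr_ge0 ?divr_ge0 // ?ffunE ?sumr_ge0 //; case: Sd.
  by rewrite -expect1 (M (fun=> 1)) expect1; case: Sd.
move=> g; rewrite /expect.
rewrite (eq_bigr (fun w => S' (w.1, w.2) * g (h w.1, w.2))); last by case.
rewrite -(pair_bigA _ (fun a b => S' (a, b) * g (h a, b))) /=.
rewrite [RHS](eq_bigr (fun w => t (w.1, w.2) * g (w.1, w.2))); last by case.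
rewrite -(pair_bigA _ (fun a b => t (a, b) * g (a, b))) /=.
rewrite exchange_big [RHS]exchange_big /=; apply: eq_bigr => b _.
(* The factor depends on [w] only through [h w], so the sum pushes forward to [p], which cancels the
   denominator. *)
transitivity (expect S (fun w => (fun a => t (a, b) / p a * g (a, b)) (h w))).
  by apply: eq_bigr => w _; rewrite ffunE /= !mulrA.
rewrite -(expect_pushforward S h (fun a => t (a, b) / p a * g (a, b))).
apply: eq_bigr => a _; rewrite -/p.
have [pa|pn] := eqVneq (p a) 0; last by rewrite mulrA mulrCA divff // mulr1.
have : \sum_b t (a, b) == 0 by rewrite tS -/p pa.
rewrite psumr_eq0 // => /allP/(_ b (mem_index_enum _))/eqP ->.
by rewrite !mul0r mulr0.
Qed.

(* The third-order moment [u] is the only free parameter; the eight positivity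
   constraints bound it by four numbers from below and four from above, and the
   sixteen comparisons are the twelve pair constraints and the four triangle
   inequalities. *)
Lemma triangle_law (x y z a b d : R) :
  `|x + y| - 1 <= a <= 1 - `|x - y| -> `|y + z| - 1 <= b <= 1 - `|y - z| ->
  `|x + z| - 1 <= d <= 1 - `|x - z| -> `|a + b| - 1 <= d <= 1 - `|a - b| ->
  exists u : R, forall p q r : bool,
    0 <= 1 + sg p * x + sg q * y + sg r * z
         + sg p * sg q * a + sg q * sg r * b + sg p * sg r * d
         + sg p * sg q * sg r * u.
Proof.
have nb (s t c : R) : `|s + t| - 1 <= c <= 1 - `|s - t| ->
  [/\ 0 <= 1 + s + t + c, 0 <= 1 - s - t + c, 0 <= 1 + s - t - c & 0 <= 1 - s + t - c].
  move=> /andP[h1 h2].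
  have : `|s + t| <= c + 1 by lra.
  have : `|s - t| <= 1 - c by lra.
  by rewrite !ler_norml => /andP[? ?] /andP[? ?]; split; lra.
move=> /nb[? ? ? ?] /nb[? ? ? ?] /nb[? ? ? ?] /nb[? ? ? ?].
(* Sign patterns of product [1] bound [u] from below; the largest of these bounds is taken and
   compared, in [u1] to [u4], with those from patterns of product [-1]. *)
pose l1 := - (1 + x + y + z + a + b + d).
pose l2 := - (1 + x - y - z - a + b - d).
pose l3 := - (1 - x + y - z - a - b + d).
pose l4 := - (1 - x - y + z + a - b - d).
pose u := Num.max (Num.max l1 l2) (Num.max l3 l4).
have : u <= u by [].
rewrite {1}/u !ge_max => /andP[/andP[h1 h2] /andP[h3 h4]].
have ub m : l1 <= m -> l2 <= m -> l3 <= m -> l4 <= m -> u <= m.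
  by move=> *; rewrite /u !ge_max; apply/andP; split; apply/andP; split.
have u1 : u <= 1 - x - y - z + a + b + d by apply: ub; rewrite /l1 /l2 /l3 /l4; lra.
have u2 : u <= 1 - x + y + z - a + b - d by apply: ub; rewrite /l1 /l2 /l3 /l4; lra.
have u3 : u <= 1 + x - y + z - a - b + d by apply: ub; rewrite /l1 /l2 /l3 /l4; lra.
have u4 : u <= 1 + x + y - z + a - b - d by apply: ub; rewrite /l1 /l2 /l3 /l4; lra.
move: h1 h2 h3 h4; rewrite /l1 /l2 /l3 /l4 => *.
by exists u; case; case; case; rewrite /sgn; lra.
Qed.

(** One gluing step: [X] and [Y] are the ends of the path so far, and the new sign is attached to
    [Y]. Conditioning on both ends is what allows the new end-to-end correlation [d] to be
    prescribed. *)
Lemma extend_by_sign (T : finType) (S : {ffun T -> R}) (X Y : T -> bool) (z b d : R) :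
  let x := expect S (fun w => sg (X w)) in
  let y := expect S (fun w => sg (Y w)) in
  let a := expect S (fun w => sg (X w) * sg (Y w)) in
  is_distr S -> `|y + z| - 1 <= b <= 1 - `|y - z| ->
  `|x + z| - 1 <= d <= 1 - `|x - z| -> `|a + b| - 1 <= d <= 1 - `|a - b| ->
  exists S' : {ffun T * bool -> R},
    [/\ is_distr S', forall f, expect S' (fun w => f w.1) = expect S f,
        expect S' (fun w => sg w.2) = z,
        expect S' (fun w => sg (Y w.1) * sg w.2) = b
      & expect S' (fun w => sg (X w.1) * sg w.2) = d].
Proof.
move=> x y a Sd hb hd hd'.
have [u tpos] := triangle_law (expect_corr_bound X Y Sd) hb hd hd'.
pose t := [ffun w : bool * bool * bool => 8^-1 * (1 + sg w.1.1 * x + sg w.1.2 * y + sg w.2 * z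
         + sg w.1.1 * sg w.1.2 * a + sg w.1.2 * sg w.2 * b + sg w.1.1 * sg w.2 * d
         + sg w.1.1 * sg w.1.2 * sg w.2 * u)].
have tE g : expect t g =
    \sum_(v : bool * bool) (t (v, true) * g (v, true) + t (v, false) * g (v, false)).
  rewrite /expect (eq_bigr (fun w => t (w.1, w.2) * g (w.1, w.2))); last by case.
  rewrite -(pair_bigA _ (fun v r => t (v, r) * g (v, r))) /=.
  by apply: eq_bigr => v _; rewrite big_bool.
have [||S' [S'd S'1 S't]] := @markov_extension _ _ _ S (fun w => (X w, Y w)) t Sd.
- by move=> [[p q] r]; rewrite ffunE /= mulr_ge0 // invr_ge0 ler0n.
- move=> [p q]; rewrite ffunE big_bool !ffunE /=.
  rewrite (joint_lawE X Y p q Sd) -/x -/y -/a.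
  by case: p; case: q; rewrite /sgn; lra.
exists S'; split=> //.
- rewrite (S't (fun w => sg w.2)) tE sum_bool2 !ffunE /= /sgn; lra.
- rewrite (S't (fun w => sg w.1.2 * sg w.2)) tE sum_bool2 !ffunE /= /sgn; lra.
- rewrite (S't (fun w => sg w.1.1 * sg w.2)) tE sum_bool2 !ffunE /= /sgn; lra.
Qed.

End Moments.

(** * Realizable endpoint correlations along a path of signs *)

Section Path.
Set Implicit Arguments.
Unset Strict Implicit.
Variable R : realType.
Local Notation sg := (sgn R).

Variables (tight : pred nat) (x b : nat -> R).

(* The largest signed sums of [b 0, ..., b n.-1] with an odd (first component)
   and an even (second component) number of minus signs, none of them on a tight
   edge.  The initial value [-2] stands for -oo: it is dominated after the first
   non-tight step because [-1 <= b 0 <= 1]. *)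
Fixpoint signed_sups (n : nat) : R * R :=
  if n is m.+1 then
    let: (A, B) := signed_sups m in
    if tight m then (A + b m, B + b m)
    else (Num.max (A + b m) (B - b m), Num.max (B + b m) (A - b m))
  else (-2, 0).

Hypothesis x_bound : forall k, `|x k| <= 1.
Hypothesis b_bound : forall k, `|x k + x k.+1| - 1 <= b k <= 1 - `|x k - x k.+1|.

Lemma corr_norm k : -1 <= b k <= 1.
Proof.
have /andP[h1 h2] := b_bound k.
have := normr_ge0 (x k + x k.+1); have := normr_ge0 (x k - x k.+1) => *.
by apply/andP; split; lra.
Qed.

(** Distances from [u] to [v] or [-v], passing through [w] or [-w]. *)
Lemma norm_triangles (u v w : R) :
  [/\ `|u - v| <= `|u - w| + `|v - w|, `|u - v| <= `|u + w| + `|v + w|,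
      `|u + v| <= `|u - w| + `|v + w| & `|u + v| <= `|u + w| + `|v - w|].
Proof.
split.
- by rewrite (distrC v) (_ : u - v = (u - w) + (w - v)) ?ler_normD //; ring.
- by rewrite (_ : u - v = (u + w) - (v + w)) ?ler_normB //; ring.
- by rewrite (_ : u + v = (u - w) + (v + w)) ?ler_normD //; ring.
- by rewrite (_ : u + v = (u + w) + (v - w)) ?ler_normD //; ring.
Qed.

(** These are the nontrivial comparisons behind [path_lo n <= path_hi n]. At [n = 0] the first one
    is an equality, thanks to the initial value [-2]. *)
Lemma signed_sups_bounds n :
  [/\ (signed_sups n).1 + (signed_sups n).2 <= 2 * n%:R - 2,
      (signed_sups n).1 + `|x 0 + x n| <= n%:R
    & (signed_sups n).2 + `|x 0 - x n| <= n%:R].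
Proof.
elim: n => [|n] /=.
  have := x_bound 0; rewrite ler_norml => /andP[h1 h2].
  have h : `|x 0 + x 0| <= 2 by rewrite ler_norml; lra.
  by rewrite subrr normr0; split; lra.
case: (signed_sups n) => A B /= [h1 h2 h3].
have /andP[c1 c2] := corr_norm n; have /andP[b1 b2] := b_bound n.
have [t1 t2 t3 t4] := norm_triangles (x 0) (x n.+1) (x n).
rewrite [`|x n.+1 - x n|]distrC ![x n.+1 + x n]addrC in t1 t2 t3 t4.
have p1 := normr_ge0 (x 0 + x n); have p2 := normr_ge0 (x 0 - x n).
rewrite -natr1.
case: (tight n) => /=; first by split; lra.
by case: (leP (A + b n) (B - b n)) => ?; case: (leP (B + b n) (A - b n)) => ?; split; lra.
Qed.

(** Closing the path by an edge of correlation [D] gives a cycle of [n.+1] edges, whose odd signed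
    sums must not exceed [n.+1 - 2]. Such a sum adds [D] to an odd sum of the path or subtracts it
    from an even one; the other bounds come from the endpoint means. *)
Definition path_lo n := Num.max (`|x 0 + x n| - 1) ((signed_sups n).2 - (n%:R - 1)).
Definition path_hi n := Num.min (1 - `|x 0 - x n|) (n%:R - 1 - (signed_sups n).1).

(** Any two means in [[-1, 1]] leave a nonempty interval of correlations, since [|u + v| + |u - v|]
    is twice the larger of [|u|] and [|v|]. *)
Lemma norm_sum_sub (u v : R) : `|u| <= 1 -> `|v| <= 1 -> `|u + v| - 1 <= 1 - `|u - v|.
Proof.
move=> hu hv; case: (ger0P (u + v)) => ?; case: (ger0P (u - v)) => ?.
all: by move: hu hv; rewrite !ler_norml => /andP[? ?] /andP[? ?]; lra.
Qed.

Lemma path_lo_hi n : path_lo n <= path_hi n.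
Proof.
have [h1 h2 h3] := signed_sups_bounds n.
have h4 := norm_sum_sub (x_bound 0) (x_bound n).
rewrite /path_lo /path_hi ge_max !le_min.
by apply/andP; split; apply/andP; split; lra.
Qed.

(** The last condition confines [D] to an interval, and the hypotheses make it meet [[lo, hi]]; the
    larger of the two left ends is a common point. *)
Lemma triangle_interval (lo hi c D' : R) :
  lo <= hi -> -1 <= c <= 1 -> -1 <= D' <= 1 ->
  lo <= c + 1 - D' -> lo <= - c + 1 + D' -> c - 1 + D' <= hi -> - c - 1 - D' <= hi ->
  exists D, lo <= D <= hi /\ `|D + c| - 1 <= D' <= 1 - `|D - c|.
Proof.
move=> lohi /andP[c1 c2] /andP[d1 d2] lo1 lo2 hi1 hi2.
pose D := Num.max lo (Num.max (c - 1 + D') (- c - 1 - D')).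
have /andP[e1 /andP[e2 e3]] : (lo <= D) && ((c - 1 + D' <= D) && (- c - 1 - D' <= D)).
  by rewrite -!ge_max.
have dub m : lo <= m -> c - 1 + D' <= m -> - c - 1 - D' <= m -> D <= m.
  by rewrite /D !ge_max => -> -> ->.
have e4 : D <= c + 1 - D' by apply: dub => //; lra.
have e5 : D <= - c + 1 + D' by apply: dub => //; lra.
have e6 : D <= hi by apply: dub.
clearbody D.
have n1 : `|D + c| <= 1 + D' by rewrite ler_norml; lra.
have n2 : `|D - c| <= 1 - D' by rewrite ler_norml; lra.
by exists D; rewrite e1 e6; split=> //; apply/andP; split; lra.
Qed.

Hypothesis b_tight : forall k, tight k -> b k = 1 - `|x k - x k.+1|.

Lemma path_step n D' : path_lo n.+1 <= D' <= path_hi n.+1 ->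
  exists D, [/\ path_lo n <= D <= path_hi n, `|x 0 + x n.+1| - 1 <= D' <= 1 - `|x 0 - x n.+1|
    & `|D + b n| - 1 <= D' <= 1 - `|D - b n|].
Proof.
have lohi := path_lo_hi n.
have [h1 h2 h3] := signed_sups_bounds n.
have /andP[c1 c2] := corr_norm n; have /andP[b1 b2] := b_bound n.
have [t1 t2 t3 t4] := norm_triangles (x 0) (x n) (x n.+1).
rewrite {1}/path_lo {1}/path_hi ge_max le_min /= => /andP[/andP[l1 l2] /andP[l3 l4]].
(* Cycle inequalities with a plus sign on the new edge. *)
have [l5 l6] : (signed_sups n).2 + b n <= D' + n%:R /\ D' <= n%:R - ((signed_sups n).1 + b n).
  move: l2 l4; rewrite -natr1; case: (signed_sups n) => A B /=.
  case: (tight n) => /=; first by move=> *; split; lra.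
  by case: (leP (A + b n) (B - b n)) => ?; case: (leP (B + b n) (A - b n)) => ? ? ?; split; lra.
(* The same with a minus sign. On a tight edge they already follow from the means by the triangle
   inequality, which is why [signed_sups] omits minus signs there. *)
have [l7 l8] : (signed_sups n).1 - b n <= D' + n%:R /\ D' <= n%:R - ((signed_sups n).2 - b n).
  move: l2 l4 h2 h3; rewrite -natr1; case: (signed_sups n) => A B /=.
  have := b_tight (k := n); case: (tight n) => /= [bt|_]; last first.
    by case: (leP (A + b n) (B - b n)) => ?; case: (leP (B + b n) (A - b n)) => *; split; lra.
  have [] := norm_triangles (x n) (x n.+1) (x 0).
  rewrite ![x _ + x 0]addrC ![`|x _ - x 0|]distrC.
  by move: (bt isT) => *; split; lra.
have lo1 : path_lo n <= b n + 1 - D' by rewrite /path_lo ge_max; apply/andP; split; lra.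
have lo2 : path_lo n <= - b n + 1 + D' by rewrite /path_lo ge_max; apply/andP; split; lra.
have hi1 : b n - 1 + D' <= path_hi n by rewrite /path_hi le_min; apply/andP; split; lra.
have hi2 : - b n - 1 - D' <= path_hi n by rewrite /path_hi le_min; apply/andP; split; lra.
have p1 := normr_ge0 (x 0 + x n.+1); have p2 := normr_ge0 (x 0 - x n.+1).
have hD' : -1 <= D' <= 1 by apply/andP; split; lra.
have [D [hD h]] := triangle_interval lohi (corr_norm n) hD' lo1 lo2 hi1 hi2.
by exists D; rewrite l1 l3.
Qed.

Lemma path_coupling n D : path_lo n <= D <= path_hi n ->
  exists (T : finType) (S : {ffun T -> R}) (X : nat -> T -> bool),
    [/\ is_distr S,
        forall k, (k <= n)%N -> expect S (fun w => sg (X k w)) = x k,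
        forall k, (k < n)%N -> expect S (fun w => sg (X k w) * sg (X k.+1 w)) = b k
      & expect S (fun w => sg (X 0 w) * sg (X n w)) = D].
Proof.
elim: n D => [|n IH] D'.
  (* For [n = 0] the initial values [-2] and [0] force [D' = 1], the correlation of a sign with
     itself. *)
  rewrite /path_lo /path_hi /= ge_max le_min => /andP[/andP[_ h1] /andP[_ h2]].
  have := x_bound 0; rewrite ler_norml => /andP[x1 x2].
  exists bool, [ffun w : bool => 2^-1 * (1 + sg w * x 0)], (fun _ w => w); split=> //.
  - split=> [w|]; last by rewrite big_bool !ffunE /sgn /=; lra.
    by rewrite ffunE /sgn; case: w => /=; lra.
  - by case=> // _; rewrite /expect big_bool !ffunE /sgn /=; lra.
  - by rewrite /expect big_bool !ffunE /sgn /=; lra.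
move=> /path_step[D [/IH[T [S [X [Sd SX Sb SD]]]] hD hD']].
have [||| S' [S'd S'1 S'z S'b S'D]] :=
  @extend_by_sign _ _ S (X 0) (X n) (x n.+1) (b n) D' Sd.
- by rewrite SX.
- by rewrite SX.
- by rewrite SD.
exists (T * bool)%type, S', (fun k w => if (k <= n)%N then X k w.1 else w.2); split=> //.
- move=> k; rewrite leq_eqVlt => /predU1P[->|]; first by rewrite ltnn.
  by rewrite ltnS => kn; rewrite kn (S'1 (fun w => sg (X k w))) SX.
- move=> k lt_kn; have /predU1P[->|kn] : (k == n) || (k < n)%N by rewrite -leq_eqVlt.
    by rewrite leqnn ltnn.
  by rewrite kn (ltnW kn) (S'1 (fun w => sg (X k w) * sg (X k.+1 w))) Sb.
- by rewrite /= ltnn.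
Qed.

End Path.

(** * Two-sign laws and maximal couplings *)

Section PairLaws.
Set Implicit Arguments.
Unset Strict Implicit.
Variable R : realType.
Local Notation sg := (sgn R).
Implicit Types q : {ffun bool * bool -> R}.

Lemma pair_law_moments q (a b : bool) : is_distr q ->
  q (a, b) = 4^-1 * (1 + sg a * expect q (fun v => sg v.1) + sg b * expect q (fun v => sg v.2)
                     + sg a * sg b * expect q (fun v => sg v.1 * sg v.2)).
Proof.
move=> qd; rewrite -(joint_lawE (fun v : bool * bool => v.1) (fun v => v.2) a b qd).
rewrite (eq_bigl (pred1 (a, b))) ?big_pred1_eq // => -[].
Qed.

Lemma marginal1E q (a : bool) : is_distr q ->
  \sum_b q (a, b) = 2^-1 * (1 + sg a * expect q (fun v => sg v.1)).
Proof.
by move=> qd; rewrite big_bool !(pair_law_moments _ _ qd); case: a; rewrite /sgn /=; lra.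
Qed.

Lemma marginal2E q (b : bool) : is_distr q ->
  \sum_a q (a, b) = 2^-1 * (1 + sg b * expect q (fun v => sg v.2)).
Proof.
by move=> qd; rewrite big_bool !(pair_law_moments _ _ qd); case: b; rewrite /sgn /=; lra.
Qed.

Lemma agreeE q : is_distr q ->
  agree q = 2^-1 * (1 + expect q (fun v => sg v.1 * sg v.2)).
Proof.
by move=> qd; rewrite /agree big_bool !(pair_law_moments _ _ qd) /sgn /=; lra.
Qed.

(** Converse of [expect_corr_bound]: the bounds make the four probabilities read off from the
    moments nonnegative. *)
Lemma exists_pair_law (x y c : R) :
  `|x + y| - 1 <= c <= 1 - `|x - y| ->
  exists q, [/\ is_distr q, expect q (fun v => sg v.1) = x, expect q (fun v => sg v.2) = y
              & expect q (fun v => sg v.1 * sg v.2) = c].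
Proof.
move=> /andP[h1 h2].
have : `|x + y| <= c + 1 by lra.
have : `|x - y| <= 1 - c by lra.
rewrite !ler_norml => /andP[? ?] /andP[? ?].
exists [ffun v => 4^-1 * (1 + sg v.1 * x + sg v.2 * y + sg v.1 * sg v.2 * c)].
split; rewrite /expect ?sum_bool2 ?ffunE /sgn /=; try lra.
split=> [[a b]|]; last by rewrite sum_bool2 !ffunE /sgn /=; lra.
by rewrite ffunE /=; case: a; case: b; rewrite /sgn /=; lra.
Qed.

(** Agreement is an increasing function of the correlation, whose upper bound [1 - |x - y|] is
    attained by the coupling [q0]. *)
Lemma maximal_couplingP (pa pb : bool -> R) (x y : R) q :
  `|x| <= 1 -> `|y| <= 1 ->
  (forall a, pa a = 2^-1 * (1 + sg a * x)) -> (forall b, pb b = 2^-1 * (1 + sg b * y)) ->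
  is_coupling2 pa pb q ->
  maximal_coupling pa pb q <-> expect q (fun v => sg v.1 * sg v.2) = 1 - `|x - y|.
Proof.
move=> hx hy hpa hpb cq.
have mom q' : is_coupling2 pa pb q' ->
    expect q' (fun v => sg v.1 * sg v.2) <= 1 - `|x - y|.
  move=> [qd [q1 q2]].
  have := expect_corr_bound (fun v : bool * bool => v.1) (fun v => v.2) qd.
  have -> : expect q' (fun v => sg v.1) = x.
    by have := q1 true; rewrite hpa (marginal1E _ qd) /sgn /=; lra.
  have -> : expect q' (fun v => sg v.2) = y.
    by have := q2 true; rewrite hpb (marginal2E _ qd) /sgn /=; lra.
  by move=> /andP[].
split=> [[_ mx]|E]; last first.
  split=> // q' cq'; have := mom _ cq'.
  by rewrite !agreeE ?E; [lra | case: cq | case: cq'].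
have [|q0 [d0 m1 m2 m3]] := @exists_pair_law x y (1 - `|x - y|).
  by rewrite (norm_sum_sub hx hy) lexx.
have c0 : is_coupling2 pa pb q0.
  by split=> //; split=> a; rewrite ?marginal1E ?marginal2E // ?m1 ?m2.
have := mx _ c0; rewrite !agreeE //; last by case: cq.
by have := mom _ cq; rewrite m3; lra.
Qed.

End PairLaws.

(** * Sums and sign parities over four cyclic indices *)

Section Cyclic4.
Set Implicit Arguments.
Unset Strict Implicit.

Lemma big_ord4 (T : Type) (idx : T) (op : Monoid.law idx) (F : 'I_4 -> T) :
  \big[op/idx]_(i < 4) F i =
  op (F (inord 0)) (op (F (inord 1)) (op (F (inord 2)) (F (inord 3)))).
Proof.
rewrite !big_ord_recl big_ord0 Monoid.mulm1.
by do !congr (op _ _); congr F; apply: val_inj; rewrite /= inordK.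
Qed.

Lemma odd_card4 (s : 'I_4 -> bool) :
  odd #|[set i | s i]| =
  s (inord 0) (+) (s (inord 1) (+) (s (inord 2) (+) s (inord 3))).
Proof.
rewrite cardsE -sum1_card big_mkcond big_ord4 /= !unfold_in.
by case: (s _); case: (s _); case: (s _); case: (s _).
Qed.

Lemma oplus1_inord k : (k < 4)%N -> oplus1 (inord k) = inord (k.+1 %% 4).
Proof. by move=> k4; apply: val_inj; rewrite /= !inordK // ltn_mod. Qed.

Variable R : realType.

Lemma signed_sum_le_s_odd (a : 'I_4 -> R) (s : {ffun 'I_4 -> bool}) :
  odd #|[set i | s i]| -> signed_sum a s <= s_odd a.
Proof. by move=> os; rewrite /s_odd; apply: (le_bigmax_cond _ (signed_sum a)). Qed.

Lemma s_odd_ge (a : 'I_4 -> R) (s0 s1 s2 s3 : bool) : s0 (+) (s1 (+) (s2 (+) s3)) ->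
  (if s0 then - a (inord 0) else a (inord 0)) + ((if s1 then - a (inord 1) else a (inord 1)) +
  ((if s2 then - a (inord 2) else a (inord 2)) + (if s3 then - a (inord 3) else a (inord 3))))
  <= s_odd a.
Proof.
move=> os; pose s := [ffun i : 'I_4 => nth false [:: s0; s1; s2; s3] i].
have := @signed_sum_le_s_odd a s; rewrite odd_card4 /signed_sum big_ord4 !ffunE !inordK //=.
exact.
Qed.

Lemma s_odd_le (a : 'I_4 -> R) (m : R) :
  (forall s : {ffun 'I_4 -> bool}, odd #|[set i | s i]| -> signed_sum a s <= m) ->
  s_odd a <= m.
Proof.
move=> h; apply: bigmax_le => //; apply: h.
(* The seed of the maximum, with its only minus sign at index 0, must itself be admissible. *)
rewrite odd_card4 !ffunE.
by rewrite -!val_eqE /= !inordK.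
Qed.

End Cyclic4.

(** * Couplings of the system: lower bound and attainment *)

Section Couplings.
Set Implicit Arguments.
Unset Strict Implicit.
Variable R : realType.
Local Notation sg := (sgn R).
Variable P : 'I_4 -> {ffun bool * bool -> R}.
Hypothesis P_distr : EPRB_system P.
Implicit Type S : {ffun Omega -> R}.

Lemma EV_bound i : `|EV P i| <= 1.
Proof. exact: (expect_sgn_bound (fun v : bool * bool => v.1) (P_distr i)). Qed.

Lemma EW_bound i : `|EW P i| <= 1.
Proof. exact: (expect_sgn_bound (fun v : bool * bool => v.2) (P_distr (ominus1 i))). Qed.

Lemma EW_oplus1 i : EW P (oplus1 i) = expect (P i) (fun v => sg v.2).
Proof. by rewrite /EW /ominus1 /oplus1 ordSK. Qed.

Lemma Ecorr_bound i :
  `|EV P i + EW P (oplus1 i)| - 1 <= Ecorr P i <= 1 - `|EV P i - EW P (oplus1 i)|.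
Proof.
rewrite EW_oplus1.
exact: (expect_corr_bound (fun v : bool * bool => v.1) (fun v => v.2) (P_distr i)).
Qed.

(** Each pair law is determined by two means and a correlation, so only moments need matching. *)
Lemma coupling_moments S : is_coupling P S <->
  [/\ is_distr S, forall i, expect S (fun w => sg (w.1 i)) = EV P i,
      forall i, expect S (fun w => sg (w.2 i)) = EW P i
    & forall i, expect S (fun w => sg (w.1 i) * sg (w.2 (oplus1 i))) = Ecorr P i].
Proof.
split=> [[Sd Sc]|[Sd SV SW Sc]]; last first.
  split=> // i a b; rewrite (joint_lawE (fun w : Omega => w.1 i) (fun w => w.2 (oplus1 i))) //.
  by rewrite SV SW Sc EW_oplus1 (pair_law_moments _ _ (P_distr i)).
have E i g : expect S (fun w => g (w.1 i, w.2 (oplus1 i))) = expect (P i) g.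
  rewrite -(expect_pushforward S (fun w : Omega => (w.1 i, w.2 (oplus1 i)))).
  apply: eq_bigr => -[a b] _; congr (_ * _); rewrite ffunE -Sc.
  by apply: eq_bigl => w; rewrite xpair_eqE.
split=> // i.
- exact: (E i (fun v => sg v.1)).
- by have := E (ominus1 i) (fun v => sg v.2); rewrite /= /oplus1 /ominus1 ord_predK.
- exact: (E i (fun v => sg v.1 * sg v.2)).
Qed.

Lemma mismatch_corr S i : is_distr S ->
  mismatch S i = 2^-1 * (1 - expect S (fun w => sg (w.1 i) * sg (w.2 i))).
Proof. exact: (mismatchE (fun w : Omega => w.1 i) (fun w => w.2 i)). Qed.

Lemma mismatch_ge S i : is_coupling P S -> 2^-1 * `|EV P i - EW P i| <= mismatch S i.
Proof.
move=> /coupling_moments[Sd SV SW _]; rewrite mismatch_corr //.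
have := expect_corr_bound (fun w : Omega => w.1 i) (fun w => w.2 i) Sd.
by rewrite SV SW => /andP[_ ?]; lra.
Qed.

Lemma sum_odd_bool (l : seq bool) : foldr addb false l -> 1 <= \sum_(c <- l) c%:R :> R.
Proof.
elim: l => //= -[] l IH; rewrite big_cons; last by rewrite add0r.
by rewrite lerDl sumr_ge0.
Qed.

(* Multiplying [V_i W_(i+1)] and [V_i W_i] around the cycle gives [1], so an odd
   number of sign changes must be paid for by a negative term or a mismatch. *)
Lemma signed_sum_mismatch (s v w : 'I_4 -> bool) : odd #|[set i | s i]| ->
  \sum_(i < 4) (if s i then - (sg (v i) * sg (w (oplus1 i))) else sg (v i) * sg (w (oplus1 i)))
  <= 2 + 2 * \sum_(i < 4) (v i != w i)%:R.
Proof.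
rewrite odd_card4 !big_ord4 !oplus1_inord //= => par.
pose c s v w := (s (+) (v (+) w))%:R : R.
have termE t a b : (if t then - (sg a * sg b) else sg a * sg b) = 1 - 2 * c t a b.
  by case: t; case: a; case: b; rewrite /c /sgn /=; lra.
rewrite !termE /c.
have xorE (a b : bool) : ((a != b)%:R : R) = (a (+) b)%:R by case: a; case: b.
rewrite !xorE.
move: (s (inord 0)) (s (inord 1)) (s (inord 2)) (s (inord 3)) par => s0 s1 s2 s3.
move: (v (inord 0)) (v (inord 1)) (v (inord 2)) (v (inord 3)) => v0 v1 v2 v3.
move: (w (inord 0)) (w (inord 1)) (w (inord 2)) (w (inord 3)) => w0 w1 w2 w3 par.
(* One bit per negative signed product and one per mismatch. Each [v] and each [w] occurs twice and
   cancels, leaving the odd parity of [s]. *)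
have : foldr addb false [:: s0 (+) (v0 (+) w1); s1 (+) (v1 (+) w2); s2 (+) (v2 (+) w3);
    s3 (+) (v3 (+) w0); v0 (+) w0; v1 (+) w1; v2 (+) w2; v3 (+) w3].
  rewrite /= addbF !addbA
    (ACl (1*4*7*10*(2*13)*(5*15)*(8*17)*(11*19)*(12*14)*(3*16)*(6*18)*(9*20))).
  by rewrite /= !addbb !addbF -!addbA.
by move=> /sum_odd_bool; rewrite !big_cons big_nil; lra.
Qed.


Lemma signed_sum_le S (s : {ffun 'I_4 -> bool}) : is_coupling P S -> odd #|[set i | s i]| ->
  signed_sum (Ecorr P) s <= 2 + 2 * \sum_(i < 4) mismatch S i.
Proof.
move=> /coupling_moments[Sd _ _ Sc] os.
have -> : signed_sum (Ecorr P) s = expect S (fun w => \sum_(i < 4)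
    (if s i then - (sg (w.1 i) * sg (w.2 (oplus1 i))) else sg (w.1 i) * sg (w.2 (oplus1 i)))).
  rewrite expect_sum; apply: eq_bigr => i _; case: (s i); rewrite -Sc //.
  by rewrite -mulN1r -expectZ; apply: eq_expect => w; rewrite mulN1r.
have -> : \sum_(i < 4) mismatch S i = expect S (fun w => \sum_(i < 4) (w.1 i != w.2 i)%:R).
  by rewrite expect_sum; apply: eq_bigr => i _; rewrite /mismatch prob_expect.
rewrite -[X in X + _](expect_cst 2 Sd) -expectZ -expectD.
by apply: expect_le => // w; apply: signed_sum_mismatch.
Qed.

Lemma Delta_lower_bound S : is_coupling P S ->
  2^-1 * Num.max (2 * Delta0 P) (s_odd (Ecorr P) - 2) <= \sum_(i < 4) mismatch S i.
Proof.
move=> Sc.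
have h1 : Delta0 P <= \sum_(i < 4) mismatch S i.
  by rewrite /Delta0 big_distrr; apply: ler_sum => i _; apply: mismatch_ge.
have h2 : s_odd (Ecorr P) <= 2 + 2 * \sum_(i < 4) mismatch S i.
  by apply: s_odd_le => s; apply: signed_sum_le.
by case: (leP (2 * Delta0 P)) => _; lra.
Qed.

Lemma pair_law_maximal S i : is_coupling P S ->
  maximal_coupling (lawV P i) (lawW P i) (pair_law S i) <->
  mismatch S i = 2^-1 * `|EV P i - EW P i|.
Proof.
move=> /coupling_moments[Sd SV SW Sc].
have plE : pair_law S i = pushforward S (fun w : Omega => (w.1 i, w.2 i)).
  by apply/ffunP => -[a b]; rewrite !ffunE; apply: eq_bigl.
have pd : is_distr (pair_law S i) by rewrite plE; apply: pushforward_distr.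
have pV : forall a, lawV P i a = 2^-1 * (1 + sg a * EV P i).
  by move=> a; rewrite /lawV marginal1E.
have pW : forall b, lawW P i b = 2^-1 * (1 + sg b * EW P i).
  by move=> b; rewrite /lawW marginal2E.
have pc : is_coupling2 (lawV P i) (lawW P i) (pair_law S i).
  split=> //; split=> a; rewrite (pV, pW) (marginal1E, marginal2E) // plE expect_pushforward /=.
    by rewrite SV.
  by rewrite SW.
rewrite (maximal_couplingP (EV_bound i) (EW_bound i) pV pW pc) mismatch_corr //.
rewrite plE expect_pushforward /=; split; lra.
Qed.

(* Vertex [i.*2] is V_i and vertex [i.*2.+1] is W_(i+1), so the odd edges are the
   ones between W_i and V_i. *)
Definition path_mean (k : nat) : R :=
  if odd k then EW P (oplus1 (inord k./2)) else EV P (inord k./2).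
Definition path_corr (k : nat) : R :=
  if odd k then 1 - `|path_mean k - path_mean k.+1| else Ecorr P (inord k./2).

Lemma path_mean_odd (i : 'I_4) : path_mean i.*2.+1 = EW P (oplus1 i).
Proof. by rewrite /path_mean /= odd_double uphalf_double inord_val. Qed.

Lemma path_mean_bound k : `|path_mean k| <= 1.
Proof. by rewrite /path_mean; case: ifP => _; rewrite ?EW_bound ?EV_bound. Qed.

Lemma path_corr_bound k :
  `|path_mean k + path_mean k.+1| - 1 <= path_corr k <= 1 - `|path_mean k - path_mean k.+1|.
Proof.
rewrite /path_corr; case: ifP => [_|ok].
  by rewrite (norm_sum_sub (path_mean_bound _) (path_mean_bound _)) lexx.
by have := Ecorr_bound (inord k./2); rewrite /path_mean /= ok uphalf_half ok.
Qed.

Lemma path_corr_tight k : odd k -> path_corr k = 1 - `|path_mean k - path_mean k.+1|.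
Proof. by rewrite /path_corr => ->. Qed.

(** Only the four even edges can carry minus signs, so the eight odd choices of [s_odd] suffice; the
    bound on [path_corr 0] disposes of the sums starting from [-2]. *)
Lemma path_odd_sup :
  (signed_sups odd path_corr 7).1 <=
  s_odd (Ecorr P) + path_corr 1 + path_corr 3 + path_corr 5.
Proof.
have := corr_norm path_corr_bound 0.
set a := Ecorr P.
have := s_odd_ge a (s0 := true) (s1 := false) (s2 := false) (s3 := false) isT.
have := s_odd_ge a (s0 := false) (s1 := true) (s2 := false) (s3 := false) isT.
have := s_odd_ge a (s0 := false) (s1 := false) (s2 := true) (s3 := false) isT.
have := s_odd_ge a (s0 := false) (s1 := false) (s2 := false) (s3 := true) isT.
have := s_odd_ge a (s0 := false) (s1 := true) (s2 := true) (s3 := true) isT.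
have := s_odd_ge a (s0 := true) (s1 := false) (s2 := true) (s3 := true) isT.
have := s_odd_ge a (s0 := true) (s1 := true) (s2 := false) (s3 := true) isT.
have := s_odd_ge a (s0 := true) (s1 := true) (s2 := true) (s3 := false) isT.
rewrite /= -[path_corr 0]/(a _) -[path_corr 2]/(a _) -[path_corr 4]/(a _) -[path_corr 6]/(a _) /=.
move: (path_corr 1) (path_corr 3) (path_corr 5) => c1 c3 c5.
move: (s_odd a) (a (inord 0)) (a (inord 1)) (a (inord 2)) (a (inord 3)) => so a0 a1 a2 a3.
move=> h1 h2 h3 h4 h5 h6 h7 h8 /andP[h9 h10].
by rewrite !addr_maxl !ge_max; do ![apply/andP; split]; lra.
Qed.

Lemma optimal_coupling : exists S, is_coupling P S /\
  \sum_(i < 4) mismatch S i <= 2^-1 * Num.max (2 * Delta0 P) (s_odd (Ecorr P) - 2).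
Proof.
have lohi := path_lo_hi odd path_mean_bound path_corr_bound 7.
(* The upper end of the interval makes the mismatch of [V_0] and [W_0] as small as the path
   allows. *)
have hD : path_lo odd path_mean path_corr 7 <= path_hi odd path_mean path_corr 7
           <= path_hi odd path_mean path_corr 7 by rewrite lohi lexx.
have [T [S [X [Sd SX Sb SD]]]] :=
  path_coupling path_mean_bound path_corr_bound path_corr_tight hD.
have half2 (i : 'I_4) : (i.*2 <= 7)%N by rewrite -ltnS -[8%N]/(4.*2) ltn_double.
have half1 (i : 'I_4) : (i.*2.+1 <= 7)%N by rewrite -ltnS -[8%N]/(4.*2) ltn_Sdouble.
pose S8 := pushforward S (fun t => ([ffun i : 'I_4 => X i.*2 t],
                                    [ffun i : 'I_4 => X (ominus1 i).*2.+1 t]) : Omega).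
have E f : expect S8 f = expect S (fun t => f ([ffun i : 'I_4 => X i.*2 t],
    [ffun i : 'I_4 => X (ominus1 i).*2.+1 t])) by rewrite expect_pushforward.
have S8d : is_distr S8 by apply: pushforward_distr.
have S8c : is_coupling P S8.
  apply/coupling_moments; split=> // i; rewrite E.
  - rewrite -[RHS](_ : path_mean i.*2 = _); last first.
      by rewrite /path_mean odd_double doubleK inord_val.
    by rewrite -(SX _ (half2 i)); apply: eq_expect => t; rewrite ffunE.
  - rewrite -[RHS](_ : path_mean (ominus1 i).*2.+1 = _); last first.
      by rewrite path_mean_odd /oplus1 /ominus1 ord_predK.
    by rewrite -(SX _ (half1 (ominus1 i))); apply: eq_expect => t; rewrite ffunE.
  - rewrite -[RHS](_ : path_corr i.*2 = _); last first.
      by rewrite /path_corr odd_double doubleK inord_val.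
    rewrite -(Sb _ (half1 i)).
    by apply: eq_expect => t; rewrite !ffunE /oplus1 /ominus1 ordSK.
exists S8; split=> //.
have mm (j : nat) : (j < 3)%N ->
    mismatch S8 (inord j.+1) = 2^-1 * (1 - path_corr j.*2.+1)
    /\ path_corr j.*2.+1 = 1 - `|EV P (inord j.+1) - EW P (inord j.+1)|.
  move=> j3.
  have oj : ominus1 (inord j.+1) = inord j :> 'I_4.
    apply: (can_inj (@ordSK 4)); rewrite /ominus1 ord_predK.
    by rewrite -/(oplus1 _) oplus1_inord ?modn_small // (leq_trans j3).
  split; last first.
    rewrite path_corr_tight /= ?odd_double // /path_mean /= odd_double /= doubleK uphalf_double.
    by rewrite oplus1_inord ?modn_small 1?distrC // (leq_trans j3).
  rewrite mismatch_corr // E -Sb; last by move: j j3 {oj} => [|[|[]]].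
  congr (_ * (_ - _)); apply: eq_expect => t.
  by rewrite !ffunE oj !inordK ?doubleS 1?mulrC // (leq_trans j3).
have m0 : mismatch S8 (inord 0) = 2^-1 * (1 - path_hi odd path_mean path_corr 7).
  rewrite mismatch_corr // E -SD; congr (_ * (_ - _)); apply: eq_expect => t.
  by rewrite !ffunE !inordK //= /ord_pred /= inordK.
have [m1 e1] : _ /\ path_corr 1 = _ := mm 0%N isT.
have [m2 e2] : _ /\ path_corr 3 = _ := mm 1%N isT.
have [m3 e3] : _ /\ path_corr 5 = _ := mm 2%N isT.
have d0 : path_mean 0 - path_mean 7 = EV P (inord 0) - EW P (inord 0).
  by rewrite /path_mean /= oplus1_inord.
have := path_odd_sup; rewrite /Delta0 !big_ord4 m0 m1 m2 m3 /path_hi d0 /=.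
rewrite -[(0.*2.+1)%N]/1%N -[(1.*2.+1)%N]/3%N -[(2.*2.+1)%N]/5%N e1 e2 e3.
move: (signed_sups odd path_corr 7).1 (s_odd (Ecorr P)) => A so hA.
move: `|_| `|_| `|_| `|_| hA => n0 n1 n2 n3 hA.
(* If [path_hi] is [1 - n0], all mismatches are minimal and their sum is [Delta0 P]. Otherwise [n1],
   [n2], [n3] cancel through [hA], and the sum is at most half of [so - 2]. *)
by case: (leP (1 - n0)) => ?; case: (leP (2 * (2^-1 * _))) => ?; lra.
Qed.

End Couplings.

Theorem theorem35 (R : realType) (P : 'I_4 -> {ffun bool * bool -> R}) :
  EPRB_system P ->
  [/\ Delta0 P = 2^-1 * \sum_(i < 4) `|EV P i - EW P i|,
      Deltamin P = 2^-1 * Num.max (2 * Delta0 P) (s_odd (Ecorr P) - 2),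
      CNTX P = 2^-1 * Num.max 0
                 (s_odd (Ecorr P) - 2 - \sum_(i < 4) `|EV P i - EW P i|)
    & (noncontextual P <->
       s_odd (Ecorr P) <= 2 + \sum_(i < 4) `|EV P i - EW P i|)].
Proof.
move=> Pd; set s := s_odd _; set n := \sum_(i < 4) _.
have D0 : Delta0 P = 2^-1 * n by [].
have [S [Sc Sle]] := optimal_coupling Pd.
have lb S' : is_coupling P S' -> _ := Delta_lower_bound Pd (S := S').
have Dmin : Deltamin P = 2^-1 * Num.max (2 * Delta0 P) (s - 2).
  have lbM : lbound [set x : R | exists S', is_coupling P S' /\
      x = \sum_(i < 4) mismatch S' i]%classic (2^-1 * Num.max (2 * Delta0 P) (s - 2)).
    by move=> _ [S' [/lb h ->]].
  apply/eqP; rewrite eq_le; apply/andP; split; last first.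
    by apply: lb_le_inf => //; exists (\sum_(i < 4) mismatch S i), S.
  apply: le_trans Sle; apply: ge_inf; last by exists S.
  by exists (2^-1 * Num.max (2 * Delta0 P) (s - 2)).
split=> //.
  rewrite /CNTX Dmin D0.
  by case: (leP (2 * (2^-1 * n)) (s - 2)) => ?; case: (leP 0 (s - 2 - n)) => ?; lra.
split=> [[S' [S'c S'max]]|sn].
  have : s - 2 <= Num.max (2 * Delta0 P) (s - 2) by rewrite le_max lexx orbT.
  have := lb _ S'c; rewrite -/s.
  have -> : \sum_(i < 4) mismatch S' i = 2^-1 * n.
    by rewrite big_distrr; apply: eq_bigr => i _; apply/(pair_law_maximal Pd).
  by lra.
exists S; split=> // i; apply/(pair_law_maximal Pd) => //; apply/eqP.
have sumS : \sum_(j < 4) mismatch S j <= 2^-1 * n.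
  by move: Sle; rewrite -/s D0; case: (leP (2 * (2^-1 * n))) => ?; lra.
(* No mismatch is below its minimum and the total does not exceed the sum of the minima, so all the
   excesses vanish. *)
have : \sum_(j < 4) (mismatch S j - 2^-1 * `|EV P j - EW P j|) == 0.
  rewrite eq_le sumr_ge0 ?andbT; last by move=> j _; rewrite subr_ge0 mismatch_ge.
  by rewrite sumrB -big_distrr /= subr_le0.
rewrite psumr_eq0; last by move=> j _; rewrite subr_ge0 mismatch_ge.
by move=> /allP/(_ i (mem_index_enum _)); rewrite subr_eq0.
Qed.
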